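(* Let $K$ be the infinite king grid. Then $\frac{1}{3} \le \textrm{ERR:LD\%}(K) \le \frac{7}{16}$.
   Context: $K$ is the infinite king grid, the 8-regular graph with vertex set $\mathbb{Z}^2$ in which two distinct vertices are adjacent iff both of their coordinates differ by at most $1$ (legal moves of a chess king). $N(v)$ is the open neighborhood of $v$ and $N[v]=N(v)\cup\{v\}$. ERR:LD sets (error-correcting locating-dominating sets) of a graph $G$: $S \subseteq V(G)$ is a set of detectors. At most one intruder is present, located at some vertex. A correctly working detector $v\in S$ transmits $2$ if the intruder is at $v$, $1$ if the intruder is in $N(v)$, and $0$ otherwise. At most one detector may transmit an incorrect value. $S$ is an ERR:LD set if, from the transmitted values, one can always determine whether an intruder is present and, if so, its exact location. Equivalently: $|N[v] \cap S| \ge 3$ for all $v\in V(G)$, and $|((N(v) \cap S) \triangle (N(u) \cap S)) - \{v,u\}| \ge 3 - |\{v,u\}\cap S|$ for all distinct $u,v\in V(G)$. $\textrm{ERR:LD\%}(G)$ denotes the minimum possible value of the density of an ERR:LD set $S$ for $G$, where the density of $S$ is the proportion of the vertices of $G$ that lie in $S$, formally $\limsup_{r\to\infty} \frac{|B_r(v)\cap S|}{|B_r(v)|}$ for any vertex $v\in V(G)$, with $B_r(v)=\{u\in V(G): d(u,v)\le r\}$. *)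

(* Defs.v *)
From HB Require Import structures.
From mathcomp Require Import all_boot all_order all_algebra finmap.
From mathcomp Require Import all_classical all_reals all_analysis.

Set Implicit Arguments.
Unset Strict Implicit.
Unset Printing Implicit Defensive.

Import Order.TTheory GRing.Theory Num.Theory.
Local Open Scope classical_set_scope.
Local Open Scope ring_scope.

Record graph := Graph {
  vertex :> choiceType;
  adj : rel vertex;
  adj_sym : symmetric adj;
  adj_irr : irreflexive adj
}.

Section Graphs.
Variable G : graph.

(* [u] is at distance at most [r] from [v] iff a walk of length at most [r]
   goes from [v] to [u]. *)
Definition gball (v : G) (r : nat) : set G :=
  [set u | exists p : seq G,
     [/\ path (@adj G) v p, last v p = u & (size p <= r)%N]].

(* The possible situations are [None] (no intruder) and [Some v] (an intruder
   at [v]). *)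
Definition true_signal (x : option G) (s : G) : 'I_3 :=
  if x is Some v then
    if s == v then inord 2 else if adj s v then inord 1 else inord 0
  else inord 0.

Definition admissible (S : set G) (x : option G) (o : S -> 'I_3) : Prop :=
  forall s t : S, o s <> true_signal x (val s) -> o t <> true_signal x (val t) ->
    s = t.

Definition err_ld (S : set G) : Prop :=
  exists decode : (S -> 'I_3) -> option G,
    forall (x : option G) (o : S -> 'I_3), admissible x o -> decode o = x.

(* [fset_set] is only meaningful on finite sets: this assumes that balls are
   finite, that is, that [G] is locally finite. *)
Definition density (R : realType) (v : G) (S : set G) : \bar R :=
  limn_esup (fun r : nat =>
    (#|` fset_set (gball v r `&` S)|%:R / #|` fset_set (gball v r)|%:R)%:E).

Definition err_ld_pct (R : realType) (v : G) : \bar R :=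
  ereal_inf [set density R v S | S in [set S | err_ld S]].

End Graphs.

Definition king_adj : rel (int * int)%type :=
  fun u v => [&& u != v, `|u.1 - v.1| <= 1 & `|u.2 - v.2| <= 1].

Lemma king_adj_sym : symmetric king_adj.
Proof.
by move=> u v; rewrite /king_adj eq_sym (distrC u.1) (distrC u.2).
Qed.

Lemma king_adj_irr : irreflexive king_adj.
Proof. by move=> u; rewrite /king_adj eqxx. Qed.

Definition king_grid : graph := Graph king_adj_sym king_adj_irr.

(* Main.v *)
(** Lower bound: if a closed neighbourhood [N[v]] held at most two detectors,
    the reading in which exactly one of them is silent, and all the detectors
    outside [N[v]] transmit 0, would be explained both by an intruder at [v] and
    by no intruder.  Hence every [N[v]] holds at least three detectors; as each
    detector lies in nine closed neighbourhoods, the density is at least 3/9.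

    Upper bound: the 4 x 4 periodic pattern
<<
        x . x .
        x x . .
        x . x .
        . . . x
>>
    of density 7/16 is an ERR:LD set.  Two situations whose correct readings
    differ at three detectors cannot explain the same faulty reading, so by
    periodicity only finitely many pairs of positions at distance at most 2 have
    to be checked; farther intruders have disjoint closed neighbourhoods, and
    each closed neighbourhood holds three detectors. *)

Require Import Defs.
From mathcomp Require Import all_boot all_order all_algebra finmap.
From mathcomp Require Import all_classical all_reals all_analysis.
From mathcomp Require Import zify ring lra.

Set Implicit Arguments.
Unset Strict Implicit.
Unset Printing Implicit Defensive.

Import Order.TTheory GRing.Theory Num.Theory.
Local Open Scope classical_set_scope.
Local Open Scope ring_scope.

(** * Limits superior up to a harmonic error *)

Lemma cvg_add_harmonic (R : realType) (l C : R) :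
  (l + C * harmonic n)%:E @[n --> \oo] --> l%:E.
Proof.
apply: cvg_EFin; first by near=> n.
rewrite -[X in _ --> X]addr0 -[X in _ + X](mulr0 C).
apply: cvgD; first exact: cvg_cst.
by apply: cvgMr; exact: cvg_harmonic.
Unshelve. all: by end_near. Qed.

(** Boundary effects in a ball of radius [n] have relative size O(1/n); this lemma and the next make
    them vanish in the density. *)
Lemma le_limn_esup_harmonic (R : realType) (l C : R) (u : R^nat) :
  (forall n, l - C * harmonic n <= u n) -> (l%:E <= limn_esup (EFin \o u))%E.
Proof.
move=> lu; rewrite limn_esup_lim.
have vl := @cvg_add_harmonic R l (- C).
rewrite -(cvg_lim _ vl) //.
apply: lee_lim; [by apply/cvg_ex; exists l%:E | exact: is_cvg_esups |].
apply: nearW => n; apply: (@le_trans _ _ (u n)%:E).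
  by rewrite lee_fin mulNr lu.
by apply: ereal_sup_ubound; exists n => //=.
Qed.

Lemma limn_esup_le_harmonic (R : realType) (l C : R) (u : R^nat) : 0 <= C ->
  (forall n, u n <= l + C * harmonic n) -> (limn_esup (EFin \o u) <= l%:E)%E.
Proof.
move=> C0 ul; rewrite limn_esup_lim.
have vl := @cvg_add_harmonic R l C.
rewrite -(cvg_lim _ vl) //.
apply: lee_lim; [exact: is_cvg_esups | by apply/cvg_ex; exists l%:E |].
apply: nearW => n; apply: ge_ereal_sup => _ [k /= nk <-].
(* As [harmonic] decreases and [0 <= C], the bound at [n] serves for the whole tail [k >= n]. *)
rewrite lee_fin (le_trans (ul k))// lerD2l ler_wpM2l//=.
by rewrite lef_pV2 ?posrE ?ltr0n// ler_nat.
Qed.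

Lemma card_fset_set_rangeI (I : finType) (T : choiceType) (f : I -> T)
    (S : set T) : injective f ->
  #|` fset_set (range f `&` S)| = #|[pred i | f i \in S]|.
Proof.
move=> f_inj.
have -> : range f `&` S = [set` [fset f i | i in [pred i | f i \in S]]%fset].
  apply/seteqP; split => [_ [[i _ <-] Sfi]|x] /=.
    by apply/imfsetP; exists i => //=; rewrite inE.
  by case/imfsetP => i /=; rewrite inE => Sfi ->; split => //; exists i.
by rewrite set_fsetK card_imfset//= -cardE.
Qed.

(** * Decoding and detector counts in an arbitrary graph *)

Section Decoding.
Variables (G : graph) (S : set G).

(** Wherever the two signals differ, the reading contradicts at least one of them; each situation
    tolerates one error, so three such detectors are too many. *)
Lemma admissible_unique (x y : option G) (o : S -> 'I_3) (l : seq G) :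
  uniq l -> (3 <= size l)%N ->
  {in l, forall s, S s /\ true_signal x s <> true_signal y s} ->
  admissible x o -> admissible y o -> False.
Proof.
case: l => [|a [|b [|c l]]] //= + _ lS ox oy.
rewrite !inE !negb_or => /andP[/and3P[ab ac _] /andP[/andP[bc _] _]].
have [Sa xya] : S a /\ true_signal x a <> true_signal y a by apply: lS; rewrite !inE eqxx.
have [Sb xyb] : S b /\ true_signal x b <> true_signal y b by apply: lS; rewrite !inE eqxx orbT.
have [Sc xyc] : S c /\ true_signal x c <> true_signal y c by apply: lS; rewrite !inE eqxx !orbT.
pose sa : S := exist _ a (mem_set Sa).
pose sb : S := exist _ b (mem_set Sb).
pose sc : S := exist _ c (mem_set Sc).
have E z (oz : admissible z o) (s t : S) : val s != val t ->
    o s = true_signal z (val s) \/ o t = true_signal z (val t).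
  move=> st; case: (pselect (o s = true_signal z (val s))) => [|ns]; first by left.
  case: (pselect (o t = true_signal z (val t))) => [|nt]; first by right.
  by case/eqP: st; rewrite (oz _ _ ns nt).
have := E x ox sa sb ab; have := E x ox sa sc ac; have := E x ox sb sc bc.
have := E y oy sa sb ab; have := E y oy sa sc ac; have := E y oy sb sc bc.
move=> /=; clear -xya xyb xyc; move: (o sa) (o sb) (o sc) xya xyb xyc => p q r.
by intuition congruence.
Qed.

Lemma err_ldP :
  (forall x y (o : S -> 'I_3), admissible x o -> admissible y o -> x = y) ->
  err_ld S.
Proof.
move=> uniq_x; exists (fun o => xget None [set x | admissible x o]) => x o ox.
by case: xgetP => [y _ oy|/(_ x)/(_ ox)//]; exact: uniq_x oy ox.
Qed.

Lemma err_ld_dominating (v : G) (l : seq G) : err_ld S ->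
  (forall s, s == v \/ adj s v -> s \in l) ->
  (3 <= count [in S] l)%N.
Proof.
case=> decode dec vl; rewrite leqNgt; apply/negP.
rewrite -size_filter.
have : {in S, forall s, s == v \/ adj s v -> s \in [seq t <- l | t \in S]}.
  by move=> s sS /vl sl; rewrite mem_filter sl /= andbT.
move: [seq t <- l | t \in S] => m mP sm.
(* [a] is the detector to silence: apart from it, [N[v]] holds at most one detector. Only [a] can
   err under [Some v], and only the other one under [None]. *)
suff [a aP] : exists a, forall s t, s \in S -> t \in S -> s == v \/ adj s v ->
    t == v \/ adj t v -> s != a -> t != a -> s = t.
  pose o (t : S) := if val t == a then inord 0 else true_signal (Some v) (val t).
  have : Some v = None; last by [].
  rewrite -(dec (Some v) o) ?(dec None o) //.
    have D (t : S) : o t <> inord 0 -> (val t == v \/ adj (val t) v) /\ val t != a.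
      rewrite /o /true_signal; case: eqVneq => [_ //|ta]; case: eqVneq => [|_].
        by split; [left|].
      by case: ifP => // vt _; split; [right|].
    move=> s t /D[sv sa] /D[tv ta]; apply: val_inj.
    by apply: aP => //; apply/mem_set; [exact: set_valP|exact: set_valP].
  move=> s t; rewrite /o; case: ifP => // /eqP sa _; case: ifP => // /eqP ta _.
  by apply: val_inj; rewrite sa ta.
case: m sm mP => [_ m0|a [_ m1|b [_ m2|//]]].
- by exists v => s t sS _ /m0; rewrite in_nil => /(_ sS).
- by exists a => s t sS _ /m1 => /(_ sS); rewrite inE => /eqP -> _; rewrite eqxx.
exists a => s t sS tS /m2 => /(_ sS) sab /m2 => /(_ tS).
by move: sab; rewrite !inE => /orP[->//|/eqP->] /orP[-> //|/eqP->].
Qed.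

End Decoding.

(** * Balls of the king grid as squares *)

Lemma king_gballE (v : king_grid) (r : nat) :
  gball v r = [set u : king_grid | `|u.1 - v.1| <= r%:Z /\ `|u.2 - v.2| <= r%:Z].
Proof.
apply/seteqP; split => u /=.
  case=> p [vp lastp pr].
  suff : `|u.1 - v.1| <= size p /\ `|u.2 - v.2| <= size p.
    by case=> h1 h2; split; [apply: le_trans h1 _|apply: le_trans h2 _];
      rewrite lez_nat.
  elim: p v vp lastp {pr} => [|w p IH] v /=; first by move=> _ <-; lia.
  rewrite {1}/king_adj => /andP[/and3P[_ + +] /IH{}IH] /IH[].
  case: u v w {IH} => [x y] [z t] [a b] /=; lia.
elim: r v => [|r IH] v uv.
  exists [::]; split => //=; move: uv; case: u v => [x y] [z t] /= uv.
  by congr pair; lia.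
(* The king moves one unit towards the target in each coordinate that still differs, so both gaps
   shrink together. *)
pose step (a b : int) := if a < b then a + 1 else if b < a then a - 1 else a.
have stepP a b : `|b - a| <= r.+1%:Z -> `|a - step a b| <= 1 /\
    `|b - step a b| <= r%:Z.
  by rewrite /step; case: ltgtP; lia.
have [->|uv_neq] := eqVneq u v; first by exists [::].
pose w : king_grid := (step v.1 u.1, step v.2 u.2).
have [/stepP[vw1 uw1] /stepP[vw2 uw2]] := uv.
have [p [wp lastp sp]] := IH w (conj uw1 uw2).
exists (w :: p); split => //=; rewrite wp andbT /king_adj vw1 vw2 !andbT.
apply: contra uv_neq => /eqP vw; move: vw (vw1); rewrite /w /step.
case: u v {uv wp lastp IH w vw1 vw2 uw1 uw2} => [x y] [z t] /= [].
by move=> h1 h2 _; apply/eqP; congr pair; move: h1 h2; do 2 case: ltgtP; lia.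
Qed.

Definition square_pt (v : king_grid) (r : nat) (p : 'I_(r.*2.+1) * 'I_(r.*2.+1)) :
    king_grid :=
  (v.1 - r%:Z + p.1%:Z, v.2 - r%:Z + p.2%:Z).

Lemma square_pt_inj v r : injective (@square_pt v r).
Proof.
move=> [i j] [k l] [h1 h2]; congr pair; apply: ord_inj; lia.
Qed.

Lemma king_gball_range (v : king_grid) (r : nat) :
  gball v r = range (@square_pt v r).
Proof.
rewrite king_gballE; case: v => z t; apply/seteqP; split => [[x y] /= [h1 h2]|_ [[i j] _ <-] /=].
  have hx : (absz (x - z + r%:Z)%R < r.*2.+1)%N by lia.
  have hy : (absz (y - t + r%:Z)%R < r.*2.+1)%N by lia.
  exists (Ordinal hx, Ordinal hy) => //.
  by rewrite /square_pt /=; congr pair; lia.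
have := ltn_ord i; have := ltn_ord j; lia.
Qed.

Lemma card_king_gballI (v : king_grid) (r : nat) (S : set king_grid) :
  #|` fset_set (gball v r `&` S)| =
  (\sum_(0 <= i < r.*2.+1) \sum_(0 <= j < r.*2.+1)
    (((v.1 - r%:Z + i%:Z, v.2 - r%:Z + j%:Z)%R : king_grid) \in S))%N.
Proof.
rewrite king_gball_range card_fset_set_rangeI; last exact: square_pt_inj.
rewrite -sum1_card big_mkcond/= big_mkord.
under [RHS]eq_bigr do rewrite big_mkord.
by rewrite pair_big /=; apply: eq_bigr => p _; rewrite inE; case: (_ \in S).
Qed.

Lemma card_king_gball (v : king_grid) (r : nat) :
  #|` fset_set (gball v r)| = (r.*2.+1 * r.*2.+1)%N.
Proof.
rewrite -[gball v r]setIT card_king_gballI.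
under eq_bigr do under eq_bigr do rewrite in_setT.
by rewrite !sum_nat_const_nat subn0 muln1.
Qed.

(** * Double counting over windows and blocks *)

Lemma sum_window_le (F : nat -> nat -> nat) (a b m n : nat) :
  (a + m <= n)%N -> (b + m <= n)%N ->
  (\sum_(0 <= i < m) \sum_(0 <= j < m) F (i + a)%N (j + b)%N <=
   \sum_(0 <= i < n) \sum_(0 <= j < n) F i j)%N.
Proof.
have sub (f : nat -> nat) c : (c + m <= n)%N ->
    (\sum_(0 <= i < m) f (i + c)%N <= \sum_(0 <= i < n) f i)%N.
  move=> cmn.
  have -> : (\sum_(0 <= i < m) f (i + c) = \sum_(c <= i < m + c) f i)%N.
    by rewrite -{2}[c]add0n big_addn addnK.
  rewrite (@big_cat_nat _ _ _ c 0 n) //=; last by lia.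
  rewrite (@big_cat_nat _ _ _ (m + c) c n) //=; lia.
move=> am bm; apply: leq_trans (sub (fun i => \sum_(0 <= j < n) F i j)%N a am).
by apply: leq_sum => i _; exact: sub.
Qed.

(** The [m * m] windows of side 3 all fit in the square of side [m.+2], and each of its cells lies
    in at most nine of them, one for each shift [(a, b)]. *)
Lemma dominated_sum_ge (F : nat -> nat -> nat) (m : nat) :
  (forall i j, 3 <= \sum_(0 <= a < 3) \sum_(0 <= b < 3) F (i + a)%N (j + b)%N)%N ->
  (3 * (m * m) <= 9 * \sum_(0 <= i < m.+2) \sum_(0 <= j < m.+2) F i j)%N.
Proof.
move=> F3.
apply: (@leq_trans (\sum_(0 <= a < 3) \sum_(0 <= b < 3)
    \sum_(0 <= i < m) \sum_(0 <= j < m) F (i + a) (j + b))%N).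
  rewrite [leqRHS](_ : _ = \sum_(0 <= i < m) \sum_(0 <= j < m)
      \sum_(0 <= a < 3) \sum_(0 <= b < 3) F (i + a) (j + b))%N.
    apply: (@leq_trans (\sum_(0 <= i < m) \sum_(0 <= j < m) 3)%N).
      by rewrite !sum_nat_const_nat !subn0; lia.
    by do 2 (apply: leq_sum => ? _).
  under eq_bigr do rewrite exchange_big /=.
  rewrite exchange_big /=; apply: eq_bigr => i _.
  under eq_bigr do rewrite exchange_big /=.
  by rewrite exchange_big.
apply: (@leq_trans (\sum_(0 <= a < 3) \sum_(0 <= b < 3)
    \sum_(0 <= i < m.+2) \sum_(0 <= j < m.+2) F i j)%N).
  rewrite big_nat [leqRHS]big_nat; apply: leq_sum => a a3.
  rewrite big_nat [leqRHS]big_nat; apply: leq_sum => b b3.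
  by apply: sum_window_le; lia.
by rewrite !sum_nat_const_nat; lia.
Qed.

Lemma sum_blocks (f : nat -> nat) (k m : nat) :
  (\sum_(0 <= i < k * m) f i = \sum_(0 <= p < m) \sum_(0 <= i < k) f (k * p + i))%N.
Proof.
elim: m => [|m IH]; first by rewrite muln0 !big_geq.
rewrite big_nat_recr //= -IH (@big_cat_nat _ _ _ (k * m)) //=; last by lia.
rewrite -{2}[(k * m)%N]add0n big_addn mulnS addnK.
by congr addn; apply: eq_bigr => i _; rewrite addnC.
Qed.

Lemma sum_square_blocks (F : nat -> nat -> nat) (k c m : nat) :
  (forall x y, \sum_(0 <= i < k) \sum_(0 <= j < k) F (x + i) (y + j) = c)%N ->
  (\sum_(0 <= i < k * m) \sum_(0 <= j < k * m) F i j = c * (m * m))%N.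
Proof.
move=> Fc; rewrite sum_blocks.
under eq_bigr do under eq_bigr do rewrite sum_blocks.
under eq_bigr do rewrite exchange_big /=.
under eq_bigr do under eq_bigr do rewrite Fc.
by rewrite !sum_nat_const_nat !subn0; lia.
Qed.

(** * The periodic pattern and its finite verification *)

(* The correct transmission of a detector at offset [w] from the intruder. *)
Definition king_signal (w : int * int) : nat :=
  if w == (0, 0) then 2%N else (`|w.1| <= 1) && (`|w.2| <= 1).

Lemma true_signal_king (v s : king_grid) :
  true_signal (Some v) s = inord (king_signal (s.1 - v.1, s.2 - v.2)).
Proof.
rewrite /true_signal /king_signal.
have -> : (s == v) = ((s.1 - v.1, s.2 - v.2) == (0, 0)).
  apply/eqP/eqP => [->|[/eqP + /eqP]]; first by rewrite !subrr.
  by rewrite !subr_eq0 => /eqP + /eqP; case: s v => [x y] [z t] /= -> ->.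
rewrite /= /king_adj.
case: eqVneq => // sv; suff -> : s != v by rewrite /=; case: (_ && _).
by apply: contra sv => /eqP ->; rewrite !subrr.
Qed.

Lemma inord_king_signal_inj (w w' : int * int) :
  (inord (king_signal w) : 'I_3) = inord (king_signal w') -> king_signal w = king_signal w'.
Proof.
have sig3 u : (king_signal u < 3)%N by rewrite /king_signal; case: ifP => // _; case: (_ && _).
by move/(congr1 (@nat_of_ord 3)); rewrite !inordK.
Qed.

Definition box (k : nat) : seq (int * int) :=
  [seq (i%:Z - k%:Z, j%:Z - k%:Z) | i <- iota 0 k.*2.+1, j <- iota 0 k.*2.+1].

Lemma mem_box (k : nat) (w : int * int) :
  `|w.1| <= k%:Z -> `|w.2| <= k%:Z -> w \in box k.
Proof.
case: w => x y /= xk yk; apply/allpairsP.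
exists (absz (x + k%:Z), absz (y + k%:Z)).
by split; rewrite ?mem_iota /=; [lia|lia|congr pair; lia].
Qed.

Lemma box_uniq (k : nat) : uniq (box k).
Proof.
apply: allpairs_uniq; [exact: iota_uniq|exact: iota_uniq|].
by move=> [i j] [i' j'] _ _ /= [? ?]; congr pair; lia.
Qed.

(** In the picture of the pattern, the first coordinate counts columns from the left and the second
    counts rows from the top. *)
Definition pattern (p : int * int) : bool :=
  ((p.1 %% 4)%Z, (p.2 %% 4)%Z) \in
    [:: (0, 0); (0, 1); (0, 2); (1, 1); (2, 0); (2, 2); (3, 3)].

(** Periodicity: a claim about every base point [c] reduces to the sixteen residues in [cell], where
    it can be computed. *)
Lemma pattern_modl (c w : int * int) :
  pattern ((c.1 %% 4)%Z + w.1, (c.2 %% 4)%Z + w.2) = pattern (c.1 + w.1, c.2 + w.2)%R.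
Proof. by rewrite /pattern /= !modzDml. Qed.

Definition cell : seq (int * int) :=
  [seq (i%:Z, j%:Z) | i <- iota 0 4, j <- iota 0 4].

Lemma mem_cell (c : int * int) : ((c.1 %% 4)%Z, (c.2 %% 4)%Z) \in cell.
Proof.
apply/allpairsP; exists (absz (c.1 %% 4)%Z, absz (c.2 %% 4)%Z).
have := modz_ge0 c.1 (isT : 4 != 0 :> int); have := ltz_pmod c.1 (isT : 0 < 4 :> int).
have := modz_ge0 c.2 (isT : 4 != 0 :> int); have := ltz_pmod c.2 (isT : 0 < 4 :> int).
by split; rewrite ?mem_iota /=; [lia|lia|congr pair; lia].
Qed.

Lemma pattern_dominating (c : int * int) :
  (3 <= count (fun w : int * int => pattern (c.1 + w.1, c.2 + w.2)%R) (box 1))%N.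
Proof.
have : all (fun c => 3 <= count (fun w : int * int =>
    pattern (c.1 + w.1, c.2 + w.2)%R) (box 1))%N cell by vm_compute.
move/allP/(_ _ (mem_cell c)).
by rewrite (eq_count (fun w => pattern_modl c w)).
Qed.

Lemma pattern_separating (c d : int * int) : d != (0, 0) ->
  `|d.1| <= 2 -> `|d.2| <= 2 ->
  (3 <= count (fun w : int * int => pattern (c.1 + w.1, c.2 + w.2)%R &&
    (king_signal w != king_signal (w.1 - d.1, w.2 - d.2)%R)) (box 3))%N.
Proof.
move=> d0 d1 d2.
(* Offsets in [box 3] suffice: with [d] in [box 2], they contain both closed neighbourhoods. *)
have : all (fun c => all (fun d => (d != (0, 0)%R) ==>
    (3 <= count (fun w : int * int => pattern (c.1 + w.1, c.2 + w.2)%R &&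
      (king_signal w != king_signal (w.1 - d.1, w.2 - d.2)%R)) (box 3))%N) (box 2)) cell.
  by vm_compute.
move/allP/(_ _ (mem_cell c))/allP/(_ d (mem_box d1 d2))/implyP/(_ d0).
by rewrite (eq_count (fun w => congr1 (andb^~ _) (pattern_modl c w))).
Qed.

Lemma pattern_cell_count (c : int * int) :
  count (fun w : int * int => pattern (c.1 + w.1, c.2 + w.2)%R) cell = 7%N.
Proof.
have : all (fun c => count (fun w : int * int =>
    pattern (c.1 + w.1, c.2 + w.2)%R) cell == 7%N) cell by vm_compute.
move/allP/(_ _ (mem_cell c)).
by rewrite (eq_count (fun w => pattern_modl c w)) => /eqP.
Qed.

Definition pattern_set : set king_grid := [set s | pattern s].

Definition discriminated (x y : option king_grid) : Prop :=
  exists l : seq king_grid, [/\ uniq l, (3 <= size l)%N &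
    {in l, forall s, pattern_set s /\ true_signal x s <> true_signal y s}].

Lemma discriminated_sym x y : discriminated x y -> discriminated y x.
Proof.
by case=> l [ul l3 lP]; exists l; split => // s /lP[Ss xy]; split => // /esym.
Qed.

Lemma discriminated_count (u : king_grid) (y : option king_grid) (k : nat) (P : pred (int * int)) :
  (forall w, P w -> true_signal (Some u) (u.1 + w.1, u.2 + w.2) <>
                    true_signal y (u.1 + w.1, u.2 + w.2)) ->
  (3 <= count (fun w : int * int => pattern (u.1 + w.1, u.2 + w.2)%R && P w) (box k))%N ->
  discriminated (Some u) y.
Proof.
move=> uy; rewrite -size_filter => sz.
exists [seq (u.1 + w.1, u.2 + w.2) | w <- box k &
   pattern (u.1 + w.1, u.2 + w.2)%R && P w]; split.
- rewrite map_inj_uniq ?filter_uniq ?box_uniq// => [[a b] [a' b']] /= [].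
  by move=> /addrI -> /addrI ->.
- by rewrite size_map.
- by move=> s /mapP[w]; rewrite mem_filter => /andP[/andP[Sw /uy ?] _] ->.
Qed.

(** The three detectors in [N[u]] hear an intruder at [u] but not [y]. This covers both the absence
    of an intruder and an intruder far away. *)
Lemma discriminated_far (u : king_grid) (y : option king_grid) :
  (forall w, `|w.1| <= 1 -> `|w.2| <= 1 ->
    true_signal y (u.1 + w.1, u.2 + w.2) = inord 0) ->
  discriminated (Some u) y.
Proof.
move=> y0; apply: (@discriminated_count u y 1 (fun w => king_signal w != 0%N)).
  move=> w; rewrite true_signal_king /= ![_ + _ - _]addrAC !subrr !add0r.
  rewrite -surjective_pairing => sw.
  have [w1 w2] : `|w.1| <= 1 /\ `|w.2| <= 1.
    move: sw; rewrite /king_signal; case: (eqVneq w (0, 0)) => [->//|_].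
    by case: (boolP (_ && _)) => // /andP.
  (* [(2, 2)] is an offset outside the closed neighbourhood: its signal is 0. *)
  by rewrite y0 // => /(@inord_king_signal_inj w (2, 2)) sw0; rewrite sw0 in sw.
have := pattern_dominating u.
rewrite -!size_filter; congr (_ <= size _)%N; apply: eq_in_filter => w wb.
suff -> : king_signal w != 0%N by rewrite andbT.
by move: w wb; apply/allP; vm_compute.
Qed.

Lemma pattern_discriminates x y : x <> y -> discriminated x y.
Proof.
have none u : discriminated (Some u) None by exact: discriminated_far.
case: x y => [u|] [v|] // uv; last by exact/discriminated_sym.
pose d : int * int := (v.1 - u.1, v.2 - u.2).
have sv (w : int * int) : true_signal (Some v) (u.1 + w.1, u.2 + w.2) =
    inord (king_signal (w.1 - d.1, w.2 - d.2)).
  by rewrite true_signal_king /=; congr (inord (king_signal (_, _))); ring.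
have [d12|] := boolP ((`|d.1| <= 2) && (`|d.2| <= 2)); last first.
  move=> far; apply: discriminated_far => w w1 w2; rewrite sv.
  congr inord; move: w1 w2 far; clearbody d; case: w d {sv} => [a b] [p q] /=.
  by rewrite /king_signal /= xpair_eqE => ? ? ?; rewrite ifF; lia.
have d0 : d != (0, 0).
  apply/eqP => -[] /eqP + /eqP; rewrite !subr_eq0 => /eqP h1 /eqP h2; apply: uv.
  by congr Some; move: h1 h2; case: (u) (v) => [? ?] [? ?] /= -> ->.
case/andP: d12 => d1 d2.
apply: discriminated_count (pattern_separating u d0 d1 d2) => w.
rewrite sv true_signal_king /= ![_ + _ - _]addrAC !subrr !add0r.
by rewrite -surjective_pairing => /eqP + /inord_king_signal_inj.
Qed.

Lemma err_ld_pattern : err_ld pattern_set.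
Proof.
apply: err_ldP => x y o ox oy; apply: contrapT => /pattern_discriminates.
by case=> l [ul l3 lP]; exact: admissible_unique ul l3 lP ox oy.
Qed.

(** * Density estimates and conclusion *)

Lemma king_ratio_ge (R : realType) (r c : nat) :
  (3 * (r.*2.-1 * r.*2.-1) <= 9 * c)%N ->
  1 / 3 - 2 * harmonic r <= c%:R / (r.*2.+1 * r.*2.+1)%:R :> R.
Proof.
(* For [r > 0] the squares of [2r+1] and [2r-1] differ by [8r], below [6(2r+1)]; the resulting error
   [2/(2r+1)] is at most [2/(r+1)]. *)
move=> rc; have {}rc : (r.*2.+1 * r.*2.+1 <= 3 * c + 6 * r.*2.+1)%N by nia.
rewrite ler_pdivlMr ?ltr0n//=.
set h : R := r.+1%:R^-1; have h0 : 0 <= h by rewrite invr_ge0.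
have hr : h * (r%:R + 1) = 1 by rewrite /h natr1 mulVf// pnatr_eq0.
move: rc; rewrite -(ler_nat R) natrD !natrM -[r.*2.+1%:R]natr1 -muln2 natrM.
have := ler0n R r; move: (r%:R : R) (c%:R : R) hr => x y hr x0 xy.
(* Since [2x+1 = x + (x+1)] and [h(x+1) = 1], the harmonic term times the area is at least [2x+1],
   which absorbs the linear error. *)
have hN : h * ((x * 2 + 1) * (x * 2 + 1)) = (1 + h * x) * (x * 2 + 1).
  by rewrite -[X in X + h * x]hr; ring.
have : 0 <= h * x * (x * 2 + 1) by rewrite !mulr_ge0//; lra.
nra.
Qed.

Lemma king_ratio_le (R : realType) (r c : nat) :
  (16 * c <= 7 * ((r.*2.+1 + 3) * (r.*2.+1 + 3)))%N ->
  c%:R / (r.*2.+1 * r.*2.+1)%:R <= 7 / 16 + 7 * harmonic r :> R.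
Proof.
(* With [n = 2r+1 >= 1], [7(n+3)^2 = 7n^2 + 42n + 63 <= 7n^2 + 105n], and [105/16 < 7] gives the
   constant of the error. *)
move=> rc; have {}rc : (16 * c <= 7 * (r.*2.+1 * r.*2.+1) + 105 * r.*2.+1)%N by nia.
rewrite ler_pdivrMr ?ltr0n//=.
set h : R := r.+1%:R^-1; have h0 : 0 <= h by rewrite invr_ge0.
have hr : h * (r%:R + 1) = 1 by rewrite /h natr1 mulVf// pnatr_eq0.
move: rc; rewrite -(ler_nat R) natrD !natrM -[r.*2.+1%:R]natr1 -muln2 natrM.
have := ler0n R r; move: (r%:R : R) (c%:R : R) hr => x y hr x0 xy.
have hN : h * ((x * 2 + 1) * (x * 2 + 1)) = (1 + h * x) * (x * 2 + 1).
  by rewrite -[X in X + h * x]hr; ring.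
have : 0 <= h * x * (x * 2 + 1) by rewrite !mulr_ge0//; lra.
nra.
Qed.

Lemma count_allpairs_iota (P : pred (int * int)) (f : nat -> nat -> int * int) (n : nat) :
  count P [seq f i j | i <- iota 0 n, j <- iota 0 n] =
  (\sum_(0 <= i < n) \sum_(0 <= j < n) P (f i j))%N.
Proof.
rewrite -sum1_count big_mkcond big_allpairs_dep /index_iota subn0.
by do 2 (apply: eq_bigr => ? _); case: (P _).
Qed.

Lemma err_ld_king_count (S : set king_grid) (x y : int) : err_ld S ->
  (3 <= \sum_(0 <= a < 3) \sum_(0 <= b < 3)
     (((x + a%:Z, y + b%:Z)%R : king_grid) \in S))%N.
Proof.
move=> Sld; rewrite -(count_allpairs_iota [in S] (fun a b => (x + a%:Z, y + b%:Z))).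
(* The window with corner [(x, y)] is the closed neighbourhood of its centre. *)
apply: (@err_ld_dominating king_grid S (x + 1, y + 1) _ Sld) => -[z t] zt.
have {zt} [zx ty] : `|z - (x + 1)| <= 1 /\ `|t - (y + 1)| <= 1.
  case: zt => [/eqP[-> ->]|/and3P[_ ? ?]]; last by split.
  by rewrite !subrr normr0.
apply/allpairsP; exists (absz (z - x), absz (t - y)).
by split; rewrite ?mem_iota /=; [lia|lia|congr pair; lia].
Qed.

Lemma err_ld_king_density_ge (R : realType) (v : king_grid) (S : set king_grid) :
  err_ld S -> ((1 / 3 : R)%:E <= density R v S)%E.
Proof.
move=> Sld; apply: le_limn_esup_harmonic => r.
rewrite card_king_gball card_king_gballI.
(* At radius 0 the truncated [r.*2.-1] is 0 and the bound is trivial; otherwise the ball has side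
   [m.+2] with [m] the predecessor of twice the radius. *)
apply: king_ratio_ge; case: r => [//|r].
apply: dominated_sum_ge => i j.
have := err_ld_king_count (v.1 - r.+1%:Z + i%:Z) (v.2 - r.+1%:Z + j%:Z) Sld.
congr (_ <= _)%N; do 2 (apply: eq_bigr => ? _).
by rewrite !PoszD !addrA.
Qed.

Lemma pattern_density_le (R : realType) (v : king_grid) :
  (density R v pattern_set <= (7 / 16 : R)%:E)%E.
Proof.
apply: (@limn_esup_le_harmonic R _ 7) => // r.
rewrite card_king_gball card_king_gballI.
apply: king_ratio_le.
pose F i j : nat := pattern (v.1 - r%:Z + i%:Z, v.2 - r%:Z + j%:Z).
(* The least number of blocks of side 4 that cover a side of the ball, so the covering square
   exceeds it by at most 3. *)
pose m := ((r.*2.+1 + 3) %/ 4)%N.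
have Fm : (\sum_(0 <= i < 4 * m) \sum_(0 <= j < 4 * m) F i j = 7 * (m * m))%N.
  apply: sum_square_blocks => i j.
  rewrite -(pattern_cell_count (v.1 - r%:Z + i%:Z, v.2 - r%:Z + j%:Z)).
  rewrite count_allpairs_iota /F.
  by do 2 (apply: eq_bigr => ? _); rewrite !PoszD !addrA.
have mr : (r.*2.+1 <= 4 * m <= r.*2.+1 + 3)%N by rewrite /m; lia.
have := @sum_window_le F 0 0 r.*2.+1 (4 * m).
rewrite !add0n Fm; case/andP: mr => mr1 mr2 /(_ mr1 mr1) le7.
apply: (@leq_trans (16 * (7 * (m * m)))%N); last by nia.
rewrite leq_mul2l /=; apply: leq_trans le7.
rewrite leq_eqVlt; apply/orP; left; apply/eqP.
do 2 (apply: eq_bigr => ? _).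
by rewrite !addn0 /F; congr nat_of_bool; apply: asboolb.
Qed.

Theorem theorem4p8 (R : realType) (v : king_grid) :
  ((1 / 3 : R)%R%:E <= err_ld_pct R v /\ err_ld_pct R v <= (7 / 16 : R)%R%:E)%E.
Proof.
split; first by apply: le_ereal_inf_tmp => _ [S Sld <-]; exact: err_ld_king_density_ge.
apply: le_trans (pattern_density_le R v).
by apply: ereal_inf_lbound; exists pattern_set => //; exact: err_ld_pattern.
Qed.
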